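(* Let $H$ be an infinite-dimensional separable complex Hilbert space, let $I$ be a countably infinite index set, and let $(x_i)_{i\in I}$ be a frame for $H$. Then there exist a scalar $a$, an orthonormal basis $(f_i)_{i\in I}$ for $H$ and a Riesz basis $(g_i)_{i\in I}$ for $H$ such that $x_i=a(f_i+g_i)$ for all $i\in I$.
   Context: A family $(x_i)_{i\in I}$ in a Hilbert space $H$ is a frame for $H$ if there are constants $0<A\le B$ such that $A\|x\|^2\le\sum_{i\in I}|\langle x,x_i\rangle|^2\le B\|x\|^2$ for all $x\in H$. A family $(g_i)_{i\in I}$ is a Riesz basis for $H$ if there are an orthonormal basis $(e_i)_{i\in I}$ for $H$ and a bounded invertible operator $R:H\to H$ (with bounded inverse) such that $Re_i=g_i$ for all $i\in I$. *)

(* Defs.v *)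
From HB Require Import structures.
From mathcomp Require Import all_boot all_order all_algebra.
From mathcomp Require Import all_classical all_reals all_analysis.
From mathcomp Require Export complex.

Set Implicit Arguments.
Unset Strict Implicit.
Unset Printing Implicit Defensive.

Import Order.TTheory GRing.Theory Num.Theory numFieldNormedType.Exports.

Local Open Scope classical_set_scope.
Local Open Scope ring_scope.

Definition separable (T : topologicalType) : Prop :=
  exists2 D : set T, countable D & dense D.

Section LinearSpan.
Context {K : pzRingType} {V : lmodType K}.

Definition lin_span (A : set V) : set V :=
  [set x | exists (n : nat) (c : 'I_n -> K) (v : 'I_n -> V),
     (forall i, A (v i)) /\ x = \sum_(i < n) c i *: v i].

End LinearSpan.

Definition infinite_dimensional (K : pzRingType) (V : lmodType K) : Prop :=
  forall A : set V, finite_set A -> lin_span A <> setT.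

(* A complex Hilbert space is a complete normed module H over R[i] together with
   a form <x, y> = dot x y (linear in x, conjugate linear in y, positive
   definite) that induces the norm. *)
Definition induces_norm (R : realType) (H : normedModType R[i])
    (dot : {dot H for Num.conj}) : Prop :=
  forall x : H, `|x| ^+ 2 = dot x x.

Section BoundedOperator.
Context {K : numFieldType} {V W : normedModType K}.

Definition bounded_operator (T : {linear V -> W}) : Prop :=
  exists M : K, forall x : V, `|T x| <= M * `|x|.

End BoundedOperator.

Section Families.
Context {R : realType} {H : completeNormedModType R[i]}.
Variable dot : {dot H for Num.conj}.
Context {I : choiceType}.

(* The norms `|z| and `|x| take their values in R[i]; they are real, and
   complex.Re maps them to R. *)
Definition is_frame (x_ : I -> H) : Prop :=
  exists A B : R, [/\ 0 < A, A <= B &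
    forall x : H,
      ((A * complex.Re `|x| ^+ 2)%:E
         <= \esum_(i in [set: I]) (complex.Re `|dot x (x_ i)| ^+ 2)%:E)%E /\
      (\esum_(i in [set: I]) (complex.Re `|dot x (x_ i)| ^+ 2)%:E
         <= (B * complex.Re `|x| ^+ 2)%:E)%E].

Definition is_orthonormal_basis (e : I -> H) : Prop :=
  (forall i j : I, dot (e i) (e j) = (i == j)%:R) /\
  dense (lin_span (range e)).

Definition is_riesz_basis (g : I -> H) : Prop :=
  exists (e : I -> H) (T S : {linear H -> H}),
    [/\ is_orthonormal_basis e,
        bounded_operator T, bounded_operator S,
        cancel T S /\ cancel S T &
        forall i : I, T (e i) = g i].

End Families.

(* Main.v *)
Require Import Defs.
From HB Require Import structures.
From mathcomp Require Import all_boot all_order all_algebra.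
From mathcomp Require Import all_classical all_reals all_analysis.
From mathcomp Require Import complex.
From mathcomp Require Import ring.

Set Implicit Arguments.
Unset Strict Implicit.
Unset Printing Implicit Defensive.

Import Order.TTheory GRing.Theory Num.Theory numFieldNormedType.Exports.

Local Open Scope classical_set_scope.
Local Open Scope ring_scope.

(** Choose an orthonormal basis [f] indexed by [I].  The upper frame inequality
says that the family is Bessel, so there is a bounded operator [T] on the whole
of [H] with [T (f i) = x_ i].  Take a scalar [a] at least twice a bound for [T]
and put [K = a^-1 *: T].  Then [K] has norm at most [1/2], so [K - 1] is
invertible by the Neumann argument, and

  [x_ i = a *: K (f i) = a *: (f i + (K - 1) (f i))],

where [g i = (K - 1) (f i)] is a Riesz basis, being the image of an orthonormal
basis under an invertible operator.

Three constructions carry this.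
- [synthesis_operator] builds [T h] as the sum of the series with terms
  [dot h (e k) *: x k].  It converges because the squared norm of a block of a
  Bessel combination is bounded by the corresponding block of the sum of squared
  coefficients ([synthesis_bound]), and the latter is summable by Bessel's
  inequality.
- [exists_orthonormal_sequence_basis] takes a maximal orthonormal set.
  Separability makes it countable, infinite dimension makes it infinite, and
  maximality makes it complete: applied with [x] equal to [e], the previous
  construction gives the Fourier series of [h], whose difference with [h] is
  orthogonal to every [e k], hence null.
- [neumann_inverse] solves [K h - h = y] by iterating [h := K h - y] from [0].

The index set enters through a bijection with [nat]: [f] is an orthonormal
sequence reindexed by [I], and [T] is built from the frame read as a sequence. *)

(** * Convergence criteria over the complex numbers *)

Section Convergence.
Context {R : realType}.
Notation C := R[i].

(** The order of [C] is only partial, but a nondecreasing sequence has real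
increments, so monotone convergence of the real parts applies. *)
Lemma bounded_nondecreasing_cauchy (s : nat -> C) (M : C) :
  (forall m n, (m <= n)%N -> s m <= s n) -> (forall n, s n <= M) ->
  forall e : C, 0 < e ->
  exists N, forall n, (N <= n)%N -> s n - s N < e.
Proof.
move=> s_nd s_le e e_gt0.
pose r n := complex.Re (s n).
have sB m n : (m <= n)%N -> s n - s m = (r n - r m)%:C%C.
  move=> mn; have : s n - s m \is Num.real by rewrite ger0_real ?subr_ge0 ?s_nd.
  by move=> /RRe_real <-; rewrite /r; case: (s n) (s m) => [? ?] [? ?].
have r_nd : {homo r : m n / (m <= n)%N >-> m <= n}.
  by move=> m n mn; have := s_nd _ _ mn; rewrite lecE => /andP[].
have r_ub : has_ubound (range r).
  exists (complex.Re M) => _ [n _ <-].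
  by have := s_le n; rewrite lecE => /andP[].
have e_re : (complex.Re e)%:C%C = e by rewrite RRe_real ?gtr0_real.
have re_gt0 : 0 < complex.Re e by move: e_gt0; rewrite ltcE => /andP[].
have r_cvg := nondecreasing_is_cvgn r_nd r_ub.
have /cvgrPdist_lt /(_ _ re_gt0) [N _ rN] := r_cvg.
exists N => n Nn; rewrite sB // -e_re ltcR.
apply: le_lt_trans (rN N (leqnn N)).
apply: le_trans (ler_norm _); rewrite lerD2r.
exact: nondecreasing_cvgn_le.
Qed.

(** The case [p = 0] serves series that converge absolutely, the case [p = 1]
series of orthogonal type, where it is the squared increments that are
controlled. *)
Lemma cvg_of_dominated_increments (H : completeNormedModType C) (u : nat -> H)
    (s : nat -> C) (M : C) (p : nat) :
  (forall m n, (m <= n)%N -> `|u n - u m| ^+ p.+1 <= s n - s m) ->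
  (forall n, s n <= M) -> cvgn u.
Proof.
move=> u_s s_le.
have s_nd m n : (m <= n)%N -> s m <= s n.
  by move=> mn; rewrite -subr_ge0 (le_trans _ (u_s _ _ mn)) ?exprn_ge0.
apply/cauchy_cvgP/cauchy_exP => e e_gt0.
have ep_gt0 : 0 < e ^+ p.+1 by rewrite exprn_gt0.
have [N sN] := bounded_nondecreasing_cauchy s_nd s_le ep_gt0.
exists (u N); exists N => // n /= Nn.
rewrite -ball_normE /= distrC.
rewrite -(ltr_pXn2r (ltn0Sn p)) ?nnegrE ?(ltW e_gt0) //.
by rewrite (le_lt_trans (u_s _ _ Nn)) ?sN.
Qed.

Lemma cvg_norm_le (H : normedModType C) (u : nat -> H) (l : H) (b : C) :
  u @ \oo --> l -> (forall n, `|u n| <= b) -> `|l| <= b.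
Proof.
move=> ul ub.
have b_ge0 : 0 <= b := le_trans (normr_ge0 _) (ub 0%N).
rewrite real_leNgt ?ger0_real //; apply/negP => bl.
have lb_gt0 : 0 < `|l| - b by rewrite subr_gt0.
have /cvgrPdist_lt /(_ _ lb_gt0) [N _ uN] := ul.
have := uN N (leqnn N); rewrite ltrBrDr.
move=> /(le_lt_trans (lerD (lexx _) (ub N))) lt1.
have := le_lt_trans (ler_normD (l - u N) (u N)) lt1.
by rewrite subrK ltxx.
Qed.

End Convergence.

(** * Finite orthonormal and Bessel sums *)

Section DotProduct.
Context {R : realType} {H : completeNormedModType R[i]}.
Notation C := R[i].
Variables (dot : {dot H for Num.conj}) (dot_norm : induces_norm dot).

Lemma dotDl x y z : dot (x + y) z = dot x z + dot y z.
Proof. exact: linearDl. Qed.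

Lemma dotZl a x z : dot (a *: x) z = a * dot x z.
Proof. exact: linearZl_LR. Qed.

Lemma dotBl x y z : dot (x - y) z = dot x z - dot y z.
Proof. exact: linearBl. Qed.

Lemma dotBr x y z : dot z (x - y) = dot z x - dot z y.
Proof. exact: linearBr. Qed.

Lemma dotC x y : dot y x = (dot x y)^*.
Proof. by have := hermC dot y x; rewrite expr0 mul1r. Qed.

Lemma dot_suml (J : Type) (r : seq J) (x : J -> H) z :
  dot (\sum_(i <- r) x i) z = \sum_(i <- r) dot (x i) z.
Proof. exact: linear_sumlz. Qed.

Definition orthonormal (J : eqType) (e : J -> H) :=
  forall i j, dot (e i) (e j) = (i == j)%:R.

(** The bound is squared so that [M] bounds the norm of the associated synthesis
operator; duplicate-free lists stand for the finite sets of indices. *)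
Definition bessel_bound (J : eqType) (x : J -> H) (M : C) :=
  forall (r : seq J) (h : H), uniq r ->
  \sum_(k <- r) `|dot h (x k)| ^+ 2 <= M ^+ 2 * `|h| ^+ 2.

Lemma dot_sum_orthonormal (J : eqType) (e : J -> H) (r : seq J) (c : J -> C) j :
  (forall k, k \in r -> dot (e k) (e j) = (k == j)%:R) -> uniq r -> j \in r ->
  dot (\sum_(k <- r) c k *: e k) (e j) = c j.
Proof.
move=> e_on r_uniq jr; rewrite dot_suml (bigD1_seq j) //=.
rewrite dotZl e_on // eqxx mulr1.
rewrite big_seq_cond big1 ?addr0 // => k /andP[kr /negPf kj].
by rewrite dotZl e_on // kj mulr0.
Qed.

(** With [u] the orthogonal projection of [h] on the span, expand
[0 <= `|h - u| ^+ 2]. *)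
Lemma bessel_inequality (J : eqType) (e : J -> H) :
  orthonormal e -> bessel_bound e 1.
Proof.
move=> e_on r h r_uniq; rewrite expr1n mul1r dot_norm.
set S := \sum_(_ <- r) _.
pose u := \sum_(k <- r) dot h (e k) *: e k.
have uh : dot u h = S.
  by rewrite dot_suml; apply: eq_bigr => k _; rewrite dotZl (dotC h) normCK.
have uu : dot u u = S.
  rewrite {1}/u dot_suml; apply: eq_big_seq => k kr.
  by rewrite dotZl (dotC u) dot_sum_orthonormal ?normCK // => i _; exact: e_on.
have hu : dot h u = S.
  have S_ge0 : 0 <= S by apply: sumr_ge0 => k _; rewrite exprn_ge0.
  by rewrite dotC uh conj_Creal // ger0_real.
have : 0 <= dot (h - u) (h - u) by rewrite -dot_norm exprn_ge0.
by rewrite dotBl !dotBr uh uu hu subrr subr0 subr_ge0.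
Qed.

(** The synthesis map is the adjoint of the analysis map, so it has the same
bound.  This can be read off a single square: with [v] the sum on the left,
expand the sum of the nonnegative terms [`|M ^+ 2 * c k - dot v (x k)| ^+ 2];
the cross terms add up to multiples of [`|v| ^+ 2] and the Bessel bound at [v]
absorbs the last ones, leaving [0 <= M ^+ 2 * (M ^+ 2 * S - `|v| ^+ 2)]. *)
Lemma synthesis_bound (J : eqType) (x : J -> H) (M : C) (r : seq J)
    (c : J -> C) :
  0 < M -> bessel_bound x M -> uniq r ->
  `|\sum_(k <- r) c k *: x k| ^+ 2 <= M ^+ 2 * \sum_(k <- r) `|c k| ^+ 2.
Proof.
move=> M_gt0 x_bes r_uniq.
set v := \sum_(_ <- r) _; set S := \sum_(_ <- r) _.
have M2_gt0 : 0 < M ^+ 2 by rewrite exprn_gt0.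
have M2_conj : (M ^+ 2)^* = M ^+ 2 by rewrite conj_Creal // gtr0_real.
have vv : \sum_(k <- r) c k * (dot v (x k))^* = `|v| ^+ 2.
  rewrite dot_norm {3}/v dot_suml; apply: eq_bigr => k _.
  by rewrite dotZl -dotC.
have vv' : \sum_(k <- r) (c k)^* * dot v (x k) = `|v| ^+ 2.
  rewrite -[RHS]conj_Creal ?ger0_real ?exprn_ge0 // -vv rmorph_sum.
  by apply: eq_bigr => k _; rewrite rmorphM /= conjCK.
have : 0 <= \sum_(k <- r) `|M ^+ 2 * c k - dot v (x k)| ^+ 2.
  by apply: sumr_ge0 => k _; rewrite exprn_ge0.
have -> : \sum_(k <- r) `|M ^+ 2 * c k - dot v (x k)| ^+ 2 =
    M ^+ 2 * (M ^+ 2 * S) - 2%:R * (M ^+ 2 * `|v| ^+ 2)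
    + \sum_(k <- r) `|dot v (x k)| ^+ 2.
  rewrite mulr2n mulrDl mul1r -{1}vv -{1}vv' /S.
  rewrite !mulr_sumr -!big_split /= -sumrB -big_split /=.
  apply: eq_bigr => k _; rewrite !normCK rmorphB rmorphM /= M2_conj; ring.
move=> pos.
have := le_trans pos (lerD (lexx _) (x_bes r v r_uniq)).
set V := `|v| ^+ 2.
have -> : M ^+ 2 * (M ^+ 2 * S) - 2%:R * (M ^+ 2 * V) + M ^+ 2 * V =
  M ^+ 2 * (M ^+ 2 * S - V) by ring.
by rewrite pmulr_rge0 // subr_ge0.
Qed.

(** * The synthesis operator of a Bessel sequence *)

(** The bounded operator that sends an orthonormal sequence to a given Bessel
sequence, and the orthogonal complement of the former to [0]. *)
Lemma synthesis_operator (e x : nat -> H) (M : C) :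
  orthonormal e -> 0 < M -> bessel_bound x M ->
  exists T : {linear H -> H}, (forall h, `|T h| <= M * `|h|) /\
    (forall h, series (fun k => dot h (e k) *: x k) @ \oo --> T h).
Proof.
move=> e_on M_gt0 x_bes.
pose S h := series (fun k => dot h (e k) *: x k).
have e_bes := bessel_inequality e_on.
have S_cvg h : cvgn (S h).
  apply: (@cvg_of_dominated_increments _ _ _
    (fun n => M ^+ 2 * \sum_(0 <= k < n) `|dot h (e k)| ^+ 2)
    (M ^+ 2 * `|h| ^+ 2) 1).
    move=> m n mn; rewrite /S -mulrBr sub_series_geq //.
    rewrite (big_cat_nat (leq0n m) mn) /= addrAC subrr add0r.
    by apply: synthesis_bound; rewrite ?iota_uniq.
  move=> n; rewrite ler_pM2l ?exprn_gt0 //.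
  by have := e_bes (index_iota 0 n) h; rewrite iota_uniq expr1n mul1r => ->.
pose T h := limn (S h).
have T_lin : linear T.
  move=> a h k.
  apply: (@norm_cvg_unique _ _ (S (a *: h + k) @ \oo)) => /=.
    exact: S_cvg.
  have -> : S (a *: h + k) = (a \*: S h) + S k.
    apply/funext => n; rewrite -[RHS]/(a *: S h n + S k n) /S /series /=.
    rewrite scaler_sumr -big_split /=.
    by apply: eq_bigr => i _; rewrite dotDl dotZl scalerDl scalerA.
  by apply: cvgD; [apply: cvgZr|]; exact: S_cvg.
pose TL : {linear H -> H} := HB.pack T (GRing.isLinear.Build _ _ _ _ T T_lin).
exists TL; split => h; last exact: S_cvg.
apply: (@cvg_norm_le _ _ (S h)); first exact: S_cvg.
move=> n; rewrite -(ler_pXn2r (ltn0Sn 1)) ?nnegrE ?mulr_ge0 ?(ltW M_gt0) //.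
rewrite exprMn.
apply: le_trans (synthesis_bound _ M_gt0 x_bes (iota_uniq _ _)) _.
rewrite ler_pM2l ?exprn_gt0 //.
by have := e_bes (index_iota 0 n) h; rewrite iota_uniq expr1n mul1r => ->.
Qed.

Lemma synthesis_orthonormal (e x : nat -> H) (T : H -> H) :
  orthonormal e ->
  (forall h, series (fun k => dot h (e k) *: x k) @ \oo --> T h) ->
  forall j, T (e j) = x j.
Proof.
move=> e_on T_lim j; apply: (norm_cvg_unique (T_lim (e j))).
apply/cvgrPdist_lt => eps eps_gt0; exists j.+1 => // n /= jn.
rewrite /series /= (bigD1_seq j) ?iota_uniq ?mem_index_iota //=.
rewrite e_on eqxx scale1r big1 ?addr0 ?subrr ?normr0 // => k /negPf kj.
by rewrite e_on eq_sym kj scale0r.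
Qed.

(** * Existence of an orthonormal basis *)

(** Continuity of [dot ^~ z], in the form of a sequence whose coefficients
stabilise: Bessel's inequality for the single unit vector [z] gives
[`|dot (l - u n) z| <= `|l - u n|]. *)
Lemma dot_cvg_const (u : nat -> H) (l z : H) (c : C) (N : nat) :
  u @ \oo --> l -> dot z z = 1 ->
  (forall n, (N <= n)%N -> dot (u n) z = c) -> dot l z = c.
Proof.
move=> ul zz uz; apply/eqP; rewrite -subr_eq0 -normr_eq0.
apply/negP => /negP d_neq0.
set d := `| _ | in d_neq0.
have d_gt0 : 0 < d by rewrite lt_def d_neq0 normr_ge0.
have /cvgrPdist_lt /(_ _ d_gt0) [N' _ uN] := ul.
have /lt_geF/negP := uN (maxn N N') (leq_maxr _ _); apply.
rewrite /d -(uz _ (leq_maxl N N')) -dotBl.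
have zo : orthonormal (fun _ : unit => z) by case; case; rewrite zz.
have := bessel_inequality zo (l - u (maxn N N')) (isT : uniq [:: tt]).
by rewrite big_seq1 expr1n mul1r ler_pXn2r ?nnegrE.
Qed.

(** The Fourier series of [h] converges to a vector with the same coefficients
as [h], hence to [h] itself by maximality. *)
Lemma dense_span_of_maximal_orthonormal (e : nat -> H) :
  orthonormal e -> (forall z, (forall k, dot z (e k) = 0) -> z = 0) ->
  dense (lin_span (range e)).
Proof.
move=> e_on e_max O [h Oh] O_open.
have [P [_ P_lim]] := synthesis_operator e_on ltr01 (bessel_inequality e_on).
have Ph : P h = h.
  apply/eqP; rewrite -subr_eq0; apply/eqP/e_max => j.
  rewrite dotBl (dot_cvg_const (c := dot h (e j)) (N := j.+1) (P_lim h)).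
  - by rewrite subrr.
  - by rewrite e_on eqxx.
  move=> n jn; rewrite /series /=.
  rewrite dot_sum_orthonormal ?iota_uniq ?mem_index_iota // => k _; exact: e_on.
have Onbhs : nbhs (P h) O by rewrite Ph; apply: open_nbhs_nbhs.
have [N _ ON] := P_lim h _ Onbhs.
exists (series (fun k => dot h (e k) *: e k) N); split.
  exact: ON (leqnn N).
exists N, (fun i => dot h (e i)), (fun i => e i); split.
  by move=> i; exists i.
by rewrite /series /= big_mkord.
Qed.

Definition orthonormal_set (E : set H) :=
  forall x y, E x -> E y -> dot x y = (x == y)%:R.

Lemma exists_maximal_orthonormal_set : exists E : set H,
  orthonormal_set E /\ forall z, (forall x, E x -> dot z x = 0) -> z = 0.
Proof.
have chain (F : set (set H)) : F `<=` orthonormal_set ->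
    total_on F subset -> orthonormal_set (\bigcup_(X in F) X).
  move=> F_on F_tot x y [X FX Xx] [Y FY Yy].
  case: (F_tot X Y FX FY) => sub.
    by apply: (F_on Y) => //; exact: sub.
  by apply: (F_on X) => //; exact: sub.
have [E [E_on E_max]] := Zorn_bigcup chain.
exists E; split=> // z zE; apply: contrapT => /eqP z_neq0.
(* Otherwise the normalisation of [z] could be added to [E]. *)
pose w := `|z|^-1 *: z.
have wE x : E x -> dot w x = 0 by move=> Ex; rewrite dotZl zE ?mulr0.
have Ew x : E x -> dot x w = 0 by move=> Ex; rewrite dotC wE ?rmorph0.
have ww : dot w w = 1.
  by rewrite -dot_norm normrZ normfV normr_id mulVf ?expr1n ?normr_eq0.
have wNE : ~ E w by move=> /wE; rewrite ww => /eqP; rewrite oner_eq0.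
apply: (E_max (E `|` [set w])).
  split; first by move=> x; left.
  by move=> /(_ w); apply/not_implyP; split=> //; right.
move=> x y [Ex|->] [Ey|->]; first exact: E_on.
- by rewrite Ew //; case: eqP => // xw; rewrite xw in Ex.
- by rewrite wE //; case: eqP => // wy; rewrite -wy in Ey.
- by rewrite ww eqxx.
Qed.

(** Two orthonormal vectors are at squared distance [2], so points of the dense
set chosen within [1/2] of each vector are distinct. *)
Lemma orthonormal_set_countable (E : set H) :
  separable H -> orthonormal_set E -> countable E.
Proof.
move=> [D /countable_injP[f f_inj] D_dense] E_on.
have half_gt0 : 0 < 2^-1 :> C by rewrite invr_gt0 ltr0n.
have near_D (x : H) : exists y, D y /\ `|x - y| < 2^-1.
  have [|y [xy Dy]] := D_dense (ball x 2^-1 : set H) _ (ball_open x _).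
    by exists x; apply: ballxx.
  by exists y; split=> //; move: xy; rewrite -ball_normE.
have /choice[d dP] := near_D.
apply/countable_injP; exists (f \o d) => x y /set_mem Ex /set_mem Ey /= fdxy.
have dxy : d x = d y by apply: f_inj => //; apply/mem_set; apply (dP _).1.
apply: contrapT => /eqP xy.
have : `|x - y| < 1.
  rewrite (splitr 1) mul1r (le_lt_trans (ler_distD (d x) x y)) //.
  rewrite ltrD ?(dP x).2 //.
  by rewrite distrC dxy (dP y).2.
rewrite -(ltr_pXn2r (ltn0Sn 1)) ?nnegrE // expr1n dot_norm dotBl !dotBr.
rewrite !E_on // !eqxx (negPf xy) eq_sym (negPf xy) subr0 sub0r opprK.
by rewrite -subr_gt0 opprD addrA subrr sub0r oppr_gt0 ltr10.
Qed.

(** A finite maximal orthonormal set would span [H]: the difference between [h]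
and its finite Fourier sum is orthogonal to the whole set. *)
Lemma maximal_orthonormal_set_infinite (E : set H) :
  infinite_dimensional H -> orthonormal_set E ->
  (forall z, (forall x, E x -> dot z x = 0) -> z = 0) -> infinite_set E.
Proof.
move=> H_inf E_on E_max E_fin; apply: (H_inf E) => //.
have [s Es] := (finite_seqP E).1 E_fin.
rewrite -subTset => h _.
pose u := undup s.
have uE k : k \in u -> E k by rewrite Es mem_undup.
have : h - \sum_(k <- u) dot h k *: k = 0.
  apply: E_max => x; rewrite Es /= -mem_undup => xu.
  rewrite dotBl dot_sum_orthonormal ?subrr ?undup_uniq // => k ku.
  by apply: E_on; apply: uE.
move=> /eqP; rewrite subr_eq0 => /eqP ->.
exists (size u), (fun i => dot h (nth 0 u i)), (fun i => nth 0 u i).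
split; first by move=> i; apply: uE; rewrite mem_nth.
by rewrite (big_nth 0) big_mkord.
Qed.

Lemma exists_orthonormal_sequence_basis :
  infinite_dimensional H -> separable H ->
  exists e : nat -> H, is_orthonormal_basis dot e.
Proof.
move=> H_inf H_sep.
have [E [E_on E_max]] := exists_maximal_orthonormal_set.
have := eq_card_nat (orthonormal_set_countable H_sep E_on)
  (maximal_orthonormal_set_infinite H_inf E_on E_max).
rewrite card_eq_sym => /card_set_bijP[e [eE e_inj e_surj]].
have e_on : orthonormal e.
  move=> i j; rewrite E_on; [|exact: eE|exact: eE].
  by congr (nat_of_bool _)%:R; apply/eqP/eqP => [/e_inj->|->]; rewrite ?inE.
exists e; split=> //.
apply: dense_span_of_maximal_orthonormal => // z ze.
by apply: E_max => x /e_surj[k _ <-]; exact: ze.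
Qed.

End DotProduct.

(** * Perturbation of the identity *)

Section Neumann.
Context {R : realType} {H : completeNormedModType R[i]}.
Notation C := R[i].

Variable K : {linear H -> H}.
Hypothesis K_half : forall h, `|K h| <= 2^-1 * `|h|.

Lemma neumann_lower h : `|h| <= 2 * `|K h - h|.
Proof.
have two_neq0 : 2 != 0 :> C by rewrite pnatr_eq0.
rewrite -ler_pdivrMl ?ltr0n // distrC; apply: le_trans (lerB_dist _ _).
rewrite lerBrDr; apply: le_trans (lerD (lexx _) (K_half h)) _.
by rewrite -mulrDl -[2^-1]mul1r -splitr mul1r.
Qed.

Lemma neumann_surjective y : exists h, K h - h = y.
Proof.
pose u n := iter n (fun h => K h - y) 0.
have uS n : u n.+1 = K (u n) - y by [].
have step n : `|u n.+1 - u n| <= 2^-1 ^+ n * `|y|.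
  elim: n => [|n IHn].
    by rewrite /u /= linear0 subr0 sub0r normrN expr0 mul1r.
  have -> : u n.+2 - u n.+1 = K (u n.+1 - u n).
    by rewrite [RHS]linearB (uS n.+1) [X in _ - X = _]uS opprB addrA subrK.
  apply: le_trans (K_half _) _.
  by rewrite exprS -mulrA ler_pM2l ?invr_gt0 ?ltr0n.
have u_cvg : cvgn u.
  (* [2 * `|y| * 2^-1 ^+ n] is the tail from [n] on of the geometric series of
     the bounds in [step], so minus it has these bounds as increments. *)
  apply: (@cvg_of_dominated_increments _ _ _
    (fun n => - (2 * `|y| * 2^-1 ^+ n)) 0 0); last first.
    by move=> n; rewrite oppr_le0 !mulr_ge0 ?exprn_ge0 ?invr_ge0 ?ler0n.
  move=> m n /subnK <-; elim: (n - m)%N => [|k IHk].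
    by rewrite !subrr normr0.
  rewrite expr1 in IHk *; apply: le_trans (ler_distD (u (k + m)%N) _ _) _.
  apply: le_trans (lerD (step _) IHk) _.
  by rewrite addSn exprS le_eqVlt; apply/orP; left; apply/eqP; field.
exists (limn u); apply/eqP; rewrite subr_eq addrC -subr_eq; apply/eqP.
apply: (@norm_cvg_unique _ _ (u n.+1 @[n --> \oo])) => /=; last first.
  by move: u_cvg; rewrite -cvg_shiftS.
apply/cvgrPdist_lt => eps eps_gt0.
have /cvgrPdist_lt /(_ _ eps_gt0) [N _ uN] := u_cvg.
exists N => // n /uN /=; apply: le_lt_trans.
rewrite opprB addrA subrK -linearB; apply: le_trans (K_half _) _.
by rewrite ler_piMl // invf_le1 ?ltr0n // ler1n.
Qed.

Lemma neumann_inverse :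
  exists S : {linear H -> H}, [/\ bounded_operator S,
    cancel (K \- idfun) S & cancel S (K \- idfun)].
Proof.
pose A : {linear H -> H} := K \- idfun.
have A_inj : injective A.
  move=> h k hk; apply/eqP; rewrite -subr_eq0 -normr_le0.
  apply: le_trans (neumann_lower _) _.
  by rewrite -[K _ - _]/(A (h - k)) linearB hk subrr normr0 mulr0.
have /choice[S AS] := neumann_surjective.
have S_lin : linear S.
  move=> a y z; apply: A_inj; rewrite linearP.
  by rewrite [A (S _)]AS [A (S y)]AS [A (S z)]AS.
pose SL : {linear H -> H} := HB.pack S (GRing.isLinear.Build _ _ _ _ S S_lin).
exists SL; split => [|h|y]; last exact: AS.
  by exists 2 => y; rewrite -{2}[y]AS; exact: neumann_lower.
by apply: A_inj; exact: AS.
Qed.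

End Neumann.

(** * The decomposition *)

Lemma bessel_of_frame (R : realType) (H : completeNormedModType R[i])
    (dot : {dot H for Num.conj}) (I : choiceType) (x_ : I -> H) :
  is_frame dot x_ -> exists B : R, 0 < B /\
    forall (r : seq I) (h : H), uniq r ->
      \sum_(k <- r) `|dot h (x_ k)| ^+ 2 <= B%:C%C * `|h| ^+ 2.
Proof.
move=> [A [B [A_gt0 AB frame]]]; exists B; split; first exact: lt_le_trans AB.
move=> r h r_uniq; have [_ ub] := frame h.
have : (\sum_(k <- r) (complex.Re `|dot h (x_ k)| ^+ 2)%:E
    <= (B * complex.Re `|h| ^+ 2)%:E)%E.
  apply: le_trans ub; apply: esum_ge; exists [set` r].
    by split=> //; exact: finite_seq.
  by rewrite -fsbig_seq.
rewrite sumEFin lee_fin -lecR rmorphM rmorphXn rmorph_sum /=.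
rewrite RRe_real ?normr_real //; apply: le_trans; apply: ler_sum => k _.
by rewrite rmorphXn.
Qed.

Theorem proposition2p10 (R : realType) (H : completeNormedModType R[i])
  (dot : {dot H for Num.conj}) (dot_norm : induces_norm dot)
  (H_inf : infinite_dimensional H) (H_sep : separable H)
  (I : choiceType) (I_count : countable [set: I])
  (I_inf : infinite_set [set: I])
  (x_ : I -> H) (x_frame : is_frame dot x_) :
  exists (a : R[i]) (f g : I -> H),
    [/\ is_orthonormal_basis dot f, is_riesz_basis dot g &
        forall i : I, x_ i = a *: (f i + g i)].
Proof.
have [e [e_on e_dense]] :=
  exists_orthonormal_sequence_basis dot_norm H_inf H_sep.
have /card_set_bijP[n_ n_bij] := eq_card_nat I_count I_inf.
move: n_bij; rewrite setTT_bijective => -[i_ n_K i_K].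
pose f i := e (n_ i).
have f_onb : is_orthonormal_basis dot f.
  split; first by move=> i j; rewrite e_on (inj_eq (can_inj n_K)).
  have -> // : range f = range e.
  apply/seteqP; split=> _ [k _ <-]; first by exists (n_ k).
  by exists (i_ k); rewrite // /f i_K.
have [B [B_gt0 x_bes]] := bessel_of_frame x_frame.
(* By the arithmetic-geometric mean inequality [M] is at least the square root
   of [B]. *)
pose M : R := (B + 1) / 2.
have M_gt0 : 0 < M by rewrite divr_gt0 // addr_gt0.
have B_le : B <= M ^+ 2.
  by rewrite -subr_ge0 (_ : _ - _ = ((B - 1) / 2) ^+ 2) ?sqr_ge0 // /M; field.
have MC_gt0 : 0 < M%:C%C by rewrite ltcR.
have y_bes : bessel_bound dot (x_ \o i_) M%:C%C.
  move=> r h r_uniq; rewrite -rmorphXn.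
  rewrite -(big_map i_ xpredT (fun k => `|dot h (x_ k)| ^+ 2)).
  apply: le_trans (x_bes _ _ _) _.
    by rewrite map_inj_uniq //; exact: can_inj i_K.
  by rewrite ler_wpM2r ?exprn_ge0 // lecR.
have [T [T_le T_lim]] := synthesis_operator dot_norm e_on MC_gt0 y_bes.
have T_e := synthesis_orthonormal e_on T_lim.
pose a : R[i] := 2 * M%:C%C.
have a_neq0 : a != 0 by rewrite mulf_neq0 ?pnatr_eq0 // gt_eqF.
pose K : {linear H -> H} := a^-1 \*: T.
have K_half h : `|K h| <= 2^-1 * `|h|.
  rewrite normrZ ger0_norm ?invr_ge0 ?mulr_ge0 ?ler0n ?(ltW MC_gt0) //.
  rewrite ler_pdivrMl ?mulr_gt0 ?ltr0n // (le_trans (T_le h)) // mulrA.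
  by rewrite /a [2 * _]mulrC mulfK ?pnatr_eq0.
have [S [S_bdd S_l S_r]] := neumann_inverse K_half.
exists a, f, (fun i => K (f i) - f i); split=> //.
  exists f, (K \- idfun), S; split=> //.
  exists (2^-1 + 1) => h; rewrite mulrDl mul1r.
  by apply: le_trans (ler_normB _ _) _; rewrite lerD2r.
by move=> i; rewrite addrC subrK scalerA mulfV // scale1r T_e /= n_K.
Qed.
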